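(* The arc-length integral converges to the arc-length. That is, for a curve $f$ on $[c,d]$, the arc-length integral $\int_c^d\sqrt{1+[f'(x)]^2}\,dx$ converges to the arc-length of $f$ on $[c,d]$.
   Context: A curve is a continuous function $f:[c,d]\to\mathbb{R}$ such that a tangent exists for $f(x)$ on $[c,d]$. The arc-length is the distance between two points along a section of a curve. The arc-length integral is defined as $$\int_c^d\sqrt{1+[f'(x)]^2}\,dx=\lim_{n\to\infty}\sum_{j}\sqrt{1+[f'(\bar{x}_j)]^2}\;\Delta x,$$ where $f'=df/dx$, $\Omega_1\subset\Omega_2\subset\cdots$ are infinitely many regular (equally spaced) partitions of $[c,d]$ whose sub-interval length $\Delta x$ (depending on $n$) tends to $0$ as $n\to\infty$, the sum is over the sub-intervals $[x_{j-1},x_j]$ of $\Omega_n$, and $\bar{x}_j\in(x_{j-1},x_j)$ is a point given by the mean value theorem, i.e. $f(x_j)-f(x_{j-1})=f'(\bar{x}_j)(x_j-x_{j-1})$. *)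

(* Defs.v *)
From HB Require Import structures.
From mathcomp Require Import all_boot all_order all_algebra.
From mathcomp Require Import all_classical all_reals all_analysis.

Set Implicit Arguments.
Unset Strict Implicit.
Unset Printing Implicit Defensive.

Import Order.TTheory GRing.Theory Num.Theory.
Import numFieldNormedType.Exports.

Local Open Scope classical_set_scope.
Local Open Scope ring_scope.

Section ArcLength.
Context {R : realType}.
Implicit Types (c d x : R) (f : R -> R).

(* The graph of f over [c, d] has a tangent at x: the slopes of the secants
   through x converge. They are taken inside [c, d], hence are one-sided at c
   and d. The limit is taken in \bar R: a finite limit is the derivative, an
   infinite one is a vertical tangent. *)
Definition has_tangent c d f x : Prop :=
  exists s : \bar R,
    ((f y - f x) / (y - x))%:E @[y --> within `[c, d] x^'] --> s.

Definition is_curve c d f : Prop :=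
  {within `[c, d], continuous f} /\
  {in `[c, d], forall x, has_tangent c d f x}.

(* As in [variation], s lists the points of the partition without the first
   one, c. *)
Definition polygon_length c d f (s : seq R) : R :=
  let X := nth d (c :: s) in
  \sum_(0 <= j < size s)
    Num.sqrt ((X j.+1 - X j) ^+ 2 + (f (X j.+1) - f (X j)) ^+ 2).

(* The length of a curve, as the supremum of the lengths of the inscribed
   polygonal lines; it is +oo for a non-rectifiable curve. *)
Definition arc_length c d f : \bar R :=
  ereal_sup [set (polygon_length c d f s)%:E | s in itv_partition c d].

(* The regular partition of [c, d] into N sub-intervals has the points
   x_0 = c, ..., x_N = d. *)
Definition regular_step c d (N : nat) : R := (d - c) / N%:R.

Definition regular_point c d (N j : nat) : R := c + j%:R * regular_step c d N.

Definition regular_partition c d (N : nat) : set R :=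
  [set regular_point c d N j | j in [set j : nat | (j <= N)%N]].

(* N n is the number of sub-intervals of the n-th partition. *)
Definition nested_regular c d (N : nat -> nat) : Prop :=
  [/\ forall n, (0 < N n)%N,
      forall n, regular_partition c d (N n) `<=` regular_partition c d (N n.+1) &
      regular_step c d (N n) @[n --> \oo] --> (0 : R)].

(* t j is the mean value point of the sub-interval [x_j, x_(j+1)], j < N.
   Derivability is required explicitly since derive1 is total. *)
Definition mean_value_points c d f (N : nat) (t : nat -> R) : Prop :=
  let x := regular_point c d N in
  forall j, (j < N)%N ->
    [/\ x j < t j < x j.+1,
        derivable f (t j) 1 &
        f (x j.+1) - f (x j) = derive1 f (t j) * (x j.+1 - x j)].

Definition arc_length_sum c d f (N : nat) (t : nat -> R) : R :=
  \sum_(0 <= j < N) Num.sqrt (1 + derive1 f (t j) ^+ 2) * regular_step c d N.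

Definition admissible c d f (N : nat -> nat) (t : nat -> nat -> R) : Prop :=
  nested_regular c d N /\ forall n, mean_value_points c d f (N n) (t n).

(* The arc-length integral of f over [c, d] converges to L in \bar R: it is the
   limit of the sums, whatever the nested regular partitions and the mean value
   points. The first clause makes L unique, by excluding that the second one
   holds vacuously. *)
Definition arc_length_integral_cvg c d f (L : \bar R) : Prop :=
  (exists N t, admissible c d f N t) /\
  forall N t, admissible c d f N t ->
    (arc_length_sum c d f (N n) (t n))%:E @[n --> \oo] --> L.

End ArcLength.

(* Main.v *)
(** By the mean value property each summand [sqrt (1 + f'(t_j)^2) * h] is the
    chord length between consecutive graph points of the regular partition, so
    the arc-length sum is the length of the regular inscribed polygon and is at
    most the arc-length. Conversely, rounding the vertices of any inscribed
    polygon down to the regular partition gives a polygon that is, by the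
    triangle inequality, no longer than the regular one, and by continuity its
    length tends to that of the original polygon as the step tends to [0]. *)
Require Import Defs.
From mathcomp Require Import all_boot all_order all_algebra.
From mathcomp Require Import all_classical all_reals all_analysis.
From mathcomp Require Import ring lra.
Import Order.TTheory GRing.Theory Num.Theory.
Import numFieldNormedType.Exports.
Local Open Scope classical_set_scope.
Local Open Scope ring_scope.

(** * Chord lengths and sums of consecutive chords *)

Section Chords.
Context {R : realType}.
Implicit Types (f : R -> R) (x : nat -> R).

Definition chord f (a b : R) : R := Num.sqrt ((b - a) ^+ 2 + (f b - f a) ^+ 2).

(** Minkowski's inequality in the plane: after squaring it reduces to the Cauchy-Schwarz bound [cs],
    whose defect is a square by Lagrange's identity. *)
Lemma sqrt_sqrD_triangle (a b u v : R) :
  Num.sqrt ((a + b) ^+ 2 + (u + v) ^+ 2) <=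
  Num.sqrt (a ^+ 2 + u ^+ 2) + Num.sqrt (b ^+ 2 + v ^+ 2).
Proof.
have sq_ge0 (p q : R) : 0 <= p ^+ 2 + q ^+ 2 by rewrite addr_ge0 ?sqr_ge0.
have cs : a * b + u * v <= Num.sqrt (a ^+ 2 + u ^+ 2) * Num.sqrt (b ^+ 2 + v ^+ 2).
  rewrite -sqrtrM// (le_trans (ler_norm _))// -sqrtr_sqr ler_sqrt ?mulr_ge0//.
  have -> : (a ^+ 2 + u ^+ 2) * (b ^+ 2 + v ^+ 2) =
            (a * b + u * v) ^+ 2 + (a * v - b * u) ^+ 2 by ring.
  by rewrite lerDl sqr_ge0.
rewrite -ler_sqr ?nnegrE ?addr_ge0 ?sqrtr_ge0// sqr_sqrtr//.
have := sqr_sqrtr (sq_ge0 a u); have := sqr_sqrtr (sq_ge0 b v).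
move: cs; set p := Num.sqrt (a ^+ 2 + _); set q := Num.sqrt _ => cs hq hp.
have -> : (p + q) ^+ 2 = p ^+ 2 + q ^+ 2 + (p * q) *+ 2 by ring.
have -> : (a + b) ^+ 2 + (u + v) ^+ 2 =
  (a ^+ 2 + u ^+ 2) + (b ^+ 2 + v ^+ 2) + (a * b + u * v) *+ 2 by ring.
by rewrite hp hq lerD2l lerMn2r.
Qed.

Lemma chord_triangle f a b e : chord f a e <= chord f a b + chord f b e.
Proof.
rewrite /chord.
have -> : e - a = (b - a) + (e - b) by ring.
have -> : f e - f a = (f b - f a) + (f e - f b) by ring.
exact: sqrt_sqrD_triangle.
Qed.

Lemma chord_le_sum f x k m : (k <= m)%N ->
  chord f (x k) (x m) <= \sum_(k <= j < m) chord f (x j) (x j.+1).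
Proof.
move=> /subnKC <-; elim: (m - k)%N => [|i IH].
  by rewrite addn0 big_geq// /chord !subrr expr0n addr0 sqrtr0.
rewrite addnS big_nat_recr ?leq_addr//=.
by rewrite (le_trans (chord_triangle _ _ (x (k + i)%N) _))// lerD2r.
Qed.

(** Each chord is bounded by the piece of polygon that it skips, and the pieces concatenate. [k] may
    repeat values, since rounding can send distinct vertices to one regular point. *)
Lemma sum_chord_le f x (k : nat -> nat) n : {homo k : i j / (i <= j)%N} ->
  \sum_(0 <= i < n) chord f (x (k i)) (x (k i.+1)) <=
  \sum_(k 0 <= j < k n) chord f (x j) (x j.+1).
Proof.
move=> kh; elim: n => [|n IH]; first by rewrite !big_geq.
rewrite big_nat_recr//= [leRHS](big_cat_nat (n := k n)) ?kh//=.
by rewrite lerD ?chord_le_sum ?kh.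
Qed.
End Chords.

(** * A mean value theorem allowing vertical tangents *)

Section MeanValue.
Context {R : realType}.
Implicit Types (f : R -> R) (a b c d k t : R).

Lemma cvg_slope_is_derive f t k :
  (f y - f t) / (y - t) @[y --> t^'] --> k -> is_derive t 1 f k.
Proof.
move=> fk.
suff H : h^-1 *: ((f \o shift t) (h *: (1 : R)) - f t) @[h --> (0:R)^'] --> k.
  by apply: DeriveDef; [apply/cvg_ex; exists k|exact: cvg_lim H].
have sh : (h + t) @[h --> (0:R)^'] --> t^'.
  move=> P; rewrite /dnbhs/within/= => tP.
  have : h + t @[h --> (0:R)] --> 0 + t.
    by apply: cvgD; [exact: cvg_id|exact: cvg_cst].
  rewrite add0r.
  move=> /(_ _ tP) H; suff : \forall h \near (0:R), h != 0 -> P (h + t) by [].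
  near=> h => h0; have : h + t != t -> P (h + t) by near: h; exact: H.
  by apply; apply: contra_neq h0 => h0; apply: (addIr t); rewrite add0r.
apply: cvg_trans (cvg_comp _ _ sh fk); apply: near_eq_cvg; near=> h.
by rewrite /= addrK /GRing.scale/= mulr1 mulrC.
Unshelve. all: by end_near. Qed.

(** Points near an interior [t] lie in [[c, d]], so restricting the secants to [[c, d]] does not
    change their limit. *)
Lemma has_tangent_interior c d f t : t \in `]c, d[ -> has_tangent c d f t ->
  exists s : \bar R, ((f y - f t) / (y - t))%:E @[y --> t^'] --> s.
Proof.
move=> tcd [s fs]; exists s; apply: cvg_trans fs; apply: cvg_app => P.
rewrite /within/= /nbhs/= => PF.
rewrite /dnbhs/within/= in PF *; near=> y => yt.
have : y != t -> `[c, d]%classic y -> P y by near: y.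
apply=> //; apply: subset_itv_oo_cc; near: y; exact: near_in_itvoo.
Unshelve. all: by end_near. Qed.

(** The bound says that [f - k id] is maximal at [t]. Divided by [y - t], it bounds the slopes by
    [k] from above on the right of [t] and from below on the left. *)
Lemma local_max_slope a b f t k (s : \bar R) : t \in `]a, b[ ->
  {in `]a, b[, forall y, f y - f t <= k * (y - t)} ->
  ((f y - f t) / (y - t))%:E @[y --> t^'] --> s -> s = k%:E.
Proof.
move=> tab fmax fs; have [at_ tb] : a < t /\ t < b by apply/andP; rewrite in_itv in tab.
apply/eqP; rewrite eq_le; apply/andP; split.
- apply: cvge_to_le (cvg_dnbhs_at_right fs) _; near=> y.
  have ty : t < y by near: y; exact: nbhs_right_gt.
  have yb : y < b by near: y; exact: nbhs_right_lt.
  rewrite lee_fin ler_pdivrMr ?subr_gt0//.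
  by rewrite fmax// in_itv/= (lt_trans at_ ty).
- apply: cvge_to_ge (cvg_dnbhs_at_left fs) _; near=> y.
  have ty : y < t by near: y; exact: nbhs_left_lt.
  have yb : a < y by near: y; exact: nbhs_left_gt.
  rewrite lee_fin ler_ndivlMr ?subr_lt0//.
  by rewrite fmax// in_itv/= yb (lt_trans ty tb).
Unshelve. all: by end_near. Qed.

Lemma local_max_derive a b f t k (s : \bar R) : t \in `]a, b[ ->
  {in `]a, b[, forall y, f y - f t <= k * (y - t)} ->
  ((f y - f t) / (y - t))%:E @[y --> t^'] --> s -> is_derive t 1 f k.
Proof.
move=> tab fmax fs; apply: cvg_slope_is_derive.
by move: (fs); rewrite (local_max_slope _ _ _ _ _ _ tab fmax fs) => /fine_cvg.
Qed.

(* Rolle's argument survives infinite slopes: at an interior extremum of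
   [f - k id] the left and right slopes of [f] are separated by [k], so their
   common limit is [k], hence finite. *)
Lemma mean_value_extended a b f : a < b -> {within `[a, b], continuous f} ->
  {in `]a, b[, forall t, exists s : \bar R,
    ((f y - f t) / (y - t))%:E @[y --> t^'] --> s} ->
  exists2 t, t \in `]a, b[ & is_derive t 1 f ((f b - f a) / (b - a)).
Proof.
move=> ab fc fs; set k := (f b - f a) / (b - a).
(* Subtracting the secant's slope makes the end values equal, as in Rolle's theorem. *)
pose g y := f y - k * y.
have gc : {within `[a, b], continuous g}.
  move=> y; apply: cvgB; first exact: fc.
  apply: continuous_subspaceT => z; exact: mulrl_continuous.
have gab : g a = g b.
  have : k * (b - a) = f b - f a by rewrite /k divfK// subr_eq0 gt_eqF.
  by rewrite /g; lra.
have [u uab gu] := EVT_max (ltW ab) gc.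
have [v vab gv] := EVT_min (ltW ab) gc.
have oo_cc y : y \in `]a, b[ -> y \in `[a, b] by exact: subset_itv_oo_cc.
have bd y : y \in `[a, b] -> (y \in `]a, b[) \/ g y = g a.
  rewrite !in_itv/= => /andP[]; rewrite !le_eqVlt => /orP[/eqP<-|ay]; first by right.
  by move=> /orP[/eqP->|yb]; [right|left; rewrite ay].
have umax t : t \in `]a, b[ -> (forall y, y \in `[a, b] -> g y <= g t) ->
    is_derive t 1 f k.
  move=> tab gt; have [s tS] := fs t tab.
  apply: local_max_derive tab _ tS => y /oo_cc/gt.
  by rewrite /g; lra.
have [uI|ga] := bd u uab; first by exists u => //; exact: umax.
have vmin t : t \in `]a, b[ -> (forall y, y \in `[a, b] -> g t <= g y) ->
    is_derive t 1 f k.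
  move=> tab gt; have [s tS] := fs t tab.
  (* A minimum is treated as a maximum for [- f] with slope [- k]. *)
  suff : is_derive t 1 (- f) (- k).
    by move=> /is_deriveN; rewrite !opprK.
  apply: (@local_max_derive a b _ _ _ (- s)%E) tab _ _.
    by move=> y /oo_cc/gt; rewrite /g /= !fctE; lra.
  apply: cvg_trans (cvgeN tS); apply: near_eq_cvg; near=> y.
  by rewrite !fctE -EFinN -mulNr opprB opprK addrC.
have [vI|ga'] := bd v vab; first by exists v => //; exact: vmin.
(* Both extrema equal the end value here, so [g] is constant on [[a, b]] and the midpoint is a
   maximum. *)
have mid : (a + b) / 2 \in `]a, b[ by rewrite in_itv/=; apply/andP; split; lra.
exists ((a + b) / 2) => //; apply: umax => // y yab.
by rewrite (le_trans (gu y yab))// ga -ga' gv// oo_cc.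
Unshelve. all: by end_near. Qed.
End MeanValue.

(** * Regular partitions and rounding down to them *)

Section Regular.
Context {R : realType}.
Implicit Types (f : R -> R) (c d y : R).

Lemma regular_point0 c d N : regular_point c d N 0 = c.
Proof. by rewrite /regular_point mul0r addr0. Qed.

Lemma regular_pointN c d N : (0 < N)%N -> regular_point c d N N = d.
Proof.
move=> N0; rewrite /regular_point /regular_step mulrC divfK ?pnatr_eq0 ?gtn_eqF//.
by rewrite addrC subrK.
Qed.

Lemma regular_pointB c d N j :
  regular_point c d N j.+1 - regular_point c d N j = regular_step c d N.
Proof. by rewrite /regular_point -natr1; ring. Qed.

Lemma regular_step_gt0 c d N : c < d -> (0 < N)%N -> 0 < regular_step c d N.
Proof. by move=> cd N0; rewrite divr_gt0 ?subr_gt0 ?ltr0n. Qed.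

Lemma regular_point_le c d N i j : c < d -> (0 < N)%N -> (i <= j)%N ->
  regular_point c d N i <= regular_point c d N j.
Proof.
by move=> cd N0 ij; rewrite lerD2l ler_wpM2r ?ler_nat// ltW ?regular_step_gt0.
Qed.

Lemma regular_point_lt c d N i j : c < d -> (0 < N)%N -> (i < j)%N ->
  regular_point c d N i < regular_point c d N j.
Proof.
by move=> cd N0 ij; rewrite ltrD2l ltr_pM2r ?ltr_nat// regular_step_gt0.
Qed.

Definition regular_polygon c d f N : R :=
  \sum_(0 <= j < N) chord f (regular_point c d N j) (regular_point c d N j.+1).

Lemma arc_length_sumE c d f N t : c < d -> (0 < N)%N ->
  mean_value_points c d f N t -> arc_length_sum c d f N t = regular_polygon c d f N.
Proof.
move=> cd N0 mv; apply: eq_big_nat => j /andP[_ jN].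
have [_ _ fj] := mv j jN.
rewrite /chord fj !regular_pointB; set h := regular_step c d N.
have -> : h ^+ 2 + (derive1 f (t j) * h) ^+ 2 = (1 + derive1 f (t j) ^+ 2) * h ^+ 2 by ring.
by rewrite sqrtrM ?addr_ge0 ?sqr_ge0// sqrtr_sqr gtr0_norm ?regular_step_gt0.
Qed.

Lemma regular_polygonP c d f N : c < d -> (0 < N)%N ->
  exists2 s, itv_partition c d s & polygon_length c d f s = regular_polygon c d f N.
Proof.
(* Partition lists omit the first point [c], hence the shift by one. *)
move=> cd N0; pose s := mkseq (fun j => regular_point c d N j.+1) N.
have Xs j : (j <= N)%N -> nth d (c :: s) j = regular_point c d N j.
  by case: j => [_|j jN]; [rewrite regular_point0|rewrite /= nth_mkseq].
exists s.
  split; last by rewrite (last_nth d) size_mkseq Xs// regular_pointN.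
  apply/(pathP d) => j; rewrite size_mkseq => jN.
  by rewrite Xs ?(ltnW jN)// nth_mkseq// regular_point_lt.
rewrite /polygon_length size_mkseq; apply: eq_big_nat => j /andP[_ jN].
by rewrite !Xs// ltnW.
Qed.

(** Index of the last regular point not exceeding [y], for [y] in [[c, d]]. The relative position of
    [y] in [[c, d]] makes it exactly [0] at [c] and [N] at [d]. *)
Definition regular_index c d N y : nat := Num.truncn (N%:R * ((y - c) / (d - c))).

Lemma regular_index_le c d N y z : c < d -> y <= z ->
  (regular_index c d N y <= regular_index c d N z)%N.
Proof.
move=> cd yz; apply: le_truncn; rewrite ler_wpM2l//.
by rewrite ler_wpM2r ?invr_ge0 ?subr_ge0 ?(ltW cd)// lerB.
Qed.

Lemma regular_indexl c d N : regular_index c d N c = 0%N.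
Proof. by rewrite /regular_index subrr mul0r mulr0 truncn0. Qed.

Lemma regular_indexr c d N : c < d -> regular_index c d N d = N.
Proof. by move=> cd; rewrite /regular_index divff ?subr_eq0 ?gt_eqF// mulr1 natrK. Qed.

Definition regular_floor c d N y : R := regular_point c d N (regular_index c d N y).

Lemma regular_floor_bounds c d N y : c < d -> (0 < N)%N -> c <= y ->
  regular_floor c d N y <= y < regular_floor c d N y + regular_step c d N.
Proof.
move=> cd N0 cy; have dc : 0 < d - c by rewrite subr_gt0.
have h0 := regular_step_gt0 _ _ _ cd N0; rewrite /regular_floor /regular_point.
(* [y] is a regular point of real index; truncating this index lowers it by less than one, hence [y]
   by less than a step. *)
have yE : y = c + N%:R * ((y - c) / (d - c)) * regular_step c d N.
  rewrite /regular_step; field.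
  by rewrite pnatr_eq0 gtn_eqF//= gt_eqF.
have /truncn_itv/andP[] : 0 <= N%:R * ((y - c) / (d - c)).
  by rewrite mulr_ge0// divr_ge0 ?subr_ge0// ltW.
rewrite -/(regular_index c d N y) -natr1 => lo hi.
apply/andP; split; first by rewrite [leRHS]yE lerD2l ler_pM2r.
rewrite [ltLHS]yE -addrA ltrD2l -[X in _ < _ + X]mul1r -mulrDl.
by rewrite ltr_pM2r.
Qed.

Lemma regular_floor_itv c d N y : c < d -> (0 < N)%N -> y \in `[c, d] ->
  regular_floor c d N y \in `[c, d].
Proof.
move=> cd N0; rewrite !in_itv/= => /andP[cy yd]; apply/andP; split.
  by rewrite -{1}(regular_point0 c d N) regular_point_le.
by have /andP[/le_trans->] := regular_floor_bounds _ _ _ _ cd N0 cy.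
Qed.

End Regular.

(** * Convergence to the arc-length and existence of admissible sums *)

Section Limits.
Context {R : realType}.
Implicit Types (f : R -> R) (c d y : R).

(** Applied with [L] the arc-length, possibly [+oo]: quantifying over the reals below [L] treats
    rectifiable and non-rectifiable curves alike. *)
Lemma cvg_EFin_upper_bound (u : nat -> R) (L : \bar R) :
  (forall n, ((u n)%:E <= L)%E) ->
  (forall a : R, (a%:E < L)%E -> \forall n \near \oo, a < u n) ->
  (u n)%:E @[n --> \oo] --> L.
Proof.
move=> uL Lu; case: L uL Lu => [l| |] uL Lu.
- apply/fine_cvgP; split; first by near=> n.
  apply/cvgrPdist_lt => e e0.
  have := Lu (l - e); rewrite lte_fin ltrBlDr ltrDl => /(_ e0); apply: filterS => n un.
  by have := uL n; rewrite lee_fin /= => ul; rewrite ger0_norm; lra.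
- apply/cvgeyPge => a; have := Lu a (ltry _); apply: filterS => n /ltW.
  by rewrite lee_fin.
(* [L] cannot be [-oo], as it bounds the real [u 0]. *)
- by have := uL 0%N; rewrite leeNy_eq.
Unshelve. all: by end_near. Qed.

Lemma chord_cvg f (a b : nat -> R) (x y : R) :
  a n @[n --> \oo] --> x -> b n @[n --> \oo] --> y ->
  f (a n) @[n --> \oo] --> f x -> f (b n) @[n --> \oo] --> f y ->
  chord f (a n) (b n) @[n --> \oo] --> chord f x y.
Proof.
move=> ax by_ fax fby; apply: continuous_cvg; first exact: sqrt_continuous.
have sqr_cvg (v : nat -> R) (l : R) : v n @[n --> \oo] --> l ->
    v n ^+ 2 @[n --> \oo] --> l ^+ 2 by move=> vl; exact: (cvgM vl vl).
by apply: cvgD; apply: sqr_cvg; exact: cvgB.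
Qed.

Lemma regular_floor_cvg c d (N : nat -> nat) y : c < d -> (forall n, (0 < N n)%N) ->
  regular_step c d (N n) @[n --> \oo] --> (0 : R) -> c <= y ->
  regular_floor c d (N n) y @[n --> \oo] --> y.
Proof.
move=> cd N0 h0 cy; apply/cvgrPdist_lt => e e0.
move/cvgrPdist_lt : h0 => /(_ _ e0); apply: filterS => n.
have := regular_floor_bounds c d (N n) y cd (N0 n) cy.
move: (regular_floor _ _ _ _) (regular_step_gt0 _ _ _ cd (N0 n)) => r.
move: (regular_step _ _ _) => h h0 /andP[ry yr].
by rewrite sub0r normrN gtr0_norm// ger0_norm ?subr_ge0//; lra.
Qed.

Lemma within_cvg_comp f c d (u : nat -> R) y : {within `[c, d], continuous f} ->
  y \in `[c, d] -> (forall n, u n \in `[c, d]) -> u n @[n --> \oo] --> y ->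
  f (u n) @[n --> \oo] --> f y.
Proof.
move=> /subspace_continuousP fc ycd ucd uy.
have ycd' : `[c, d]%classic y by [].
apply: (cvg_comp _ _ _ (fc y ycd')) => P yP.
have H : \forall n \near \oo, `[c, d]%classic (u n) -> P (u n) := uy _ yP.
suff : \forall n \near \oo, P (u n) by [].
by move: H; apply: filterS => n; apply; exact: ucd.
Qed.

Lemma polygon_length_lt_regular c d f (N : nat -> nat) s (a : R) : c < d ->
  {within `[c, d], continuous f} -> (forall n, (0 < N n)%N) ->
  regular_step c d (N n) @[n --> \oo] --> (0 : R) ->
  itv_partition c d s -> a < polygon_length c d f s ->
  \forall n \near \oo, a < regular_polygon c d f (N n).
Proof.
move=> cd fc N0 h0 ps aP; pose X := nth d (c :: s).
(* The default [d] keeps [X] at [d] beyond the end, so [X] is monotone on all indices, as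
   [sum_chord_le] requires. *)
have Xd i : (size s <= i)%N -> X i = d.
  rewrite leq_eqVlt => /orP[/eqP<-|?]; last by rewrite /X nth_default.
  by rewrite /X (itv_partition_nth_size _ ps).
have Xh : {homo X : i j / (i <= j)%N >-> i <= j}.
  apply: homo_leq => // [|i]; first exact: le_trans.
  have [si|si] := leqP (size s) i; first by rewrite !Xd// ltnW.
  by case: ps => /(pathP d)/(_ i si)/ltW.
have Xcd i : X i \in `[c, d].
  rewrite in_itv/= -[c]/(X 0%N) Xh//= -(Xd (maxn i (size s))) ?leq_maxr//.
  by rewrite Xh ?leq_maxl.
pose r n i := regular_floor c d (N n) (X i).
have rX i : r n i @[n --> \oo] --> X i.
  by apply: regular_floor_cvg => //; move: (Xcd i); rewrite in_itv/= => /andP[].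
have frX i : f (r n i) @[n --> \oo] --> f (X i).
  by apply: within_cvg_comp => // n; exact: regular_floor_itv.
(* The number of chords is fixed by [s] while [n] grows, so the limit is taken termwise. *)
have TX : \sum_(0 <= i < size s) chord f (r n i) (r n i.+1) @[n --> \oo] -->
    polygon_length c d f s.
  by apply: cvg_big => [|i _]; [exact: add_continuous|exact: chord_cvg].
have : \forall n \near \oo, a < \sum_(0 <= i < size s) chord f (r n i) (r n i.+1).
  exact: cvgr_gt TX _ aP.
apply: filterS => n /lt_le_trans; apply.
have kh : {homo (fun i => regular_index c d (N n) (X i)) : i j / (i <= j)%N}.
  by move=> i j ij; rewrite regular_index_le// Xh.
(* [X] runs from [c] to [d], so the indices run from [0] to [N n] and the bound is the whole regular
   polygon. *)
have := sum_chord_le f (regular_point c d (N n)) _ (size s) kh.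
by rewrite regular_indexl Xd// regular_indexr.
Qed.

Lemma regular_polygon_cvg c d f (N : nat -> nat) : c < d ->
  {within `[c, d], continuous f} -> (forall n, (0 < N n)%N) ->
  regular_step c d (N n) @[n --> \oo] --> (0 : R) ->
  (regular_polygon c d f (N n))%:E @[n --> \oo] --> arc_length c d f.
Proof.
move=> cd fc N0 h0; apply: cvg_EFin_upper_bound => [n|a].
  have [s ps <-] := regular_polygonP c d f (N n) cd (N0 n).
  by apply: ereal_sup_ubound; exists s.
move=> /ereal_sup_gt[_ [s ps <-]]; rewrite lte_fin => aP.
exact: polygon_length_lt_regular aP.
Qed.

Lemma mean_value_points_exist c d f N : c < d -> (0 < N)%N -> is_curve c d f ->
  exists t, mean_value_points c d f N t.
Proof.
move=> cd N0 [fc ft]; pose x := regular_point c d N.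
suff P j : exists t, (j < N)%N -> [/\ x j < t < x j.+1, derivable f t 1 &
    f (x j.+1) - f (x j) = derive1 f t * (x j.+1 - x j)].
  by have [t tP] := choice P; exists t.
(* Choice needs a value for every [j]; beyond the last sub-interval [0] is a dummy. *)
have [jN|_] := ltnP j N; last by exists 0.
have xx : x j < x j.+1 by exact: regular_point_lt.
have cx : c <= x j by rewrite -(regular_point0 c d N) regular_point_le.
have xd : x j.+1 <= d by rewrite -[leRHS](regular_pointN c d N N0) regular_point_le.
have fx : {within `[x j, x j.+1], continuous f}.
  by apply: continuous_subspaceW fc; apply: subset_itv; rewrite bnd_simp.
have [u|t txx dt] := mean_value_extended (x j) (x j.+1) f xx fx.
  rewrite in_itv/= => /andP[xu ux].
  have ucd : u \in `]c, d[ by rewrite in_itv/= (le_lt_trans cx)// (lt_le_trans ux).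
  apply: (has_tangent_interior _ _ _ _ ucd); apply: ft; rewrite in_itv/=.
  by rewrite (le_trans cx (ltW xu)) (le_trans (ltW ux) xd).
exists t => _; split; first by rewrite in_itv/= in txx.
  exact: ex_derive.
by rewrite derive1E derive_val divfK// subr_eq0 gt_eqF.
Qed.

(** Dyadic partitions are nested because point [j] of one level is point [2j] of the next. *)
Lemma nested_regular_pow2 c d : nested_regular c d (fun n => 2 ^ n)%N.
Proof.
split => [n|n _ [j jn <-]|]; first by rewrite expn_gt0.
  exists j.*2; first by rewrite /= expnS mul2n leq_double.
  rewrite /regular_point /regular_step expnS -muln2 !natrM; field.
  by rewrite pnatr_eq0 expn_eq0.
rewrite [X in X @ _ --> _](_ : _ = geometric (d - c) 2^-1).
  by apply: cvg_geometric; rewrite ger0_norm//; lra.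
by apply/funext => n; rewrite /regular_step/= natrX exprVn.
Qed.

End Limits.

Theorem corollary6 (R : realType) (c d : R) (f : R -> R) (ltcd : c < d)
    (curve_f : is_curve c d f) :
  arc_length_integral_cvg c d f (arc_length c d f).

Proof.
split=> [|N t [[N0 _ h0] mv]].
  have tP n := mean_value_points_exist c d f (2 ^ n) ltcd (expn_gt0 2 n) curve_f.
  have [t tN] := choice tP.
  by exists (fun n => 2 ^ n)%N, t; split => //; exact: nested_regular_pow2.
(* The mean value property removes [t]: only the lengths of the regular polygons remain. *)
rewrite (_ : (fun n => _) = fun n => (regular_polygon c d f (N n))%:E).
  by apply: regular_polygon_cvg => //; case: curve_f.
by apply/funext => n; rewrite arc_length_sumE.
Qed.
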